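(* Let $\mathcal{O}$ be a context specifier. (1) If $\Lambda$ is a modulus, then $\Lambda|_{\mathcal{O}}$ is a modulus which refines $\Lambda$. (2) If $\Lambda_1$ and $\Lambda_2$ are moduli, then $(\Lambda_1 \vee \Lambda_2)|_{\mathcal{O}} = (\Lambda_1|_{\mathcal{O}}) \vee (\Lambda_2|_{\mathcal{O}})$. (3) For every modulus $\Lambda$, $\mathrm{pt}(\Lambda|_{\mathcal{O}}) = \mathrm{In}_{\mathcal{O}}(\mathrm{pt}(\Lambda))$; that is, the square with horizontal maps $\mathrm{pt} : \mathbf{MD} \to \mathbf{PV}$ and vertical maps $(-)|_{\mathcal{O}} : \mathbf{MD} \to \mathbf{MD}$ and $\mathrm{In}_{\mathcal{O}} : \mathbf{PV} \to \mathbf{PV}$ commutes.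
   Context: For a finite semigroup $S$ (the empty semigroup is allowed), $\mathcal{P}(S)$ is the set of non-empty subsets of $S$ and $\mathrm{sing}(S)$ is the set of singletons. A homomorphism $\varphi : S \to T$ extends to $\dot\varphi : \mathcal{P}(S) \to \mathcal{P}(T)$, $X \mapsto \{\varphi(x) : x \in X\}$. A modulus $\Lambda$ is a rule assigning to each finite semigroup $S$ a (possibly empty) set $\Lambda_S \subseteq \mathcal{P}(S)$ such that: (i) for every homomorphism $\varphi : S \to T$ and $X \in \Lambda_S$ there is $\widetilde{X} \in \Lambda_T$ with $\dot\varphi(X) \subseteq \widetilde{X}$; (ii) for every surjective homomorphism $\varphi : S \to T$ and $Y \in \Lambda_T$ there is $\widetilde{Y} \in \Lambda_S$ with $\dot\varphi(\widetilde{Y}) = Y$. $\mathbf{MD}$ is the collection of moduli. A modulus $\Lambda_1$ refines $\Lambda_2$ if for all $S$ every $X_1 \in \Lambda_{1,S}$ is a subset of some $X_2 \in \Lambda_{2,S}$. The join of $\Lambda_1,\Lambda_2$ is $(\Lambda_1\vee\Lambda_2)_S = \Lambda_{1,S}\cup\Lambda_{2,S}$. The points of $\Lambda$ are $\mathrm{pt}(\Lambda) = \{ S : \Lambda_S \subseteq \mathrm{sing}(S) \}$, which is a pseudovariety. A context specifier $\mathcal{O}$ is a rule assigning to each finite semigroup $S$ a (possibly empty) set $\mathcal{O}(S)$ of subsemigroups of $S$ such that: (i) for all homomorphisms $\varphi : S \to T$ and $U_S \in \mathcal{O}(S)$ there is $U_T \in \mathcal{O}(T)$ with $\varphi(U_S)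 \subseteq U_T$; (ii) for all surjective homomorphisms $\varphi : S \to T$ and $U_T \in \mathcal{O}(T)$ there is $U_S \in \mathcal{O}(S)$ with $\varphi(U_S) = U_T$. The restriction of a modulus $\Lambda$ to the context $\mathcal{O}$ is the rule $\Lambda|_{\mathcal{O}}$ given by $(\Lambda|_{\mathcal{O}})_S = \bigcup_{U \in \mathcal{O}(S)} \Lambda_U$ (subsets of $U$ are regarded as subsets of $S$). A pseudovariety is a class of finite semigroups closed under subsemigroups, homomorphic images and finite products; $\mathbf{PV}$ is the lattice of pseudovarieties. For $\mathbf{V} \in \mathbf{PV}$, $\mathrm{In}_{\mathcal{O}}(\mathbf{V}) = \{ S : \mathcal{O}(S) \subseteq \mathbf{V}\}$, which is a pseudovariety. *)

(* Defs.v *)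
From HB Require Import structures.
From mathcomp Require Import all_boot.

Set Implicit Arguments.
Unset Strict Implicit.
Unset Printing Implicit Defensive.

Local Open Scope group_scope.

(* The carrier of a semigroupType may be empty, so the empty semigroup is
   included. Homomorphisms are {multiplicative S -> T}. *)
#[short(type="finSemigroupType")]
HB.structure Definition FinSemigroup := {S of Semigroup S & Finite S}.

(* The empty subset counts as a subsemigroup. *)
Record subsemigroup (S : finSemigroupType) := Subsemigroup {
  subsg_set :> {set S};
  subsg_closed : [forall x in subsg_set, forall y in subsg_set,
                    x * y \in subsg_set]
}.

HB.instance Definition _ S := [isSub for @subsg_set S].
HB.instance Definition _ S := [Finite of subsemigroup S by <:].

Lemma subsg_mulg_closed (S : finSemigroupType) (U : subsemigroup S) :
  mulg_closed [pred x in U].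
Proof.
by move=> x y Ux Uy; have /forall_inP/(_ x Ux)/forall_inP := subsg_closed U;
  apply.
Qed.

Definition subsg_type (S : finSemigroupType) (U : subsemigroup S) : Type :=
  {x : S | x \in U}.

Section SubsgType.
Variables (S : finSemigroupType) (U : subsemigroup S).
HB.instance Definition _ := SubType.on (subsg_type U).
HB.instance Definition _ := [Finite of subsg_type U by <:].
HB.instance Definition _ := SubChoice_isSubSemigroup.Build S [pred x in U]
  (subsg_type U) (@subsg_mulg_closed S U).
End SubsgType.

(* U as a finite semigroup in its own right; val is its inclusion into S. *)
Definition sg_of (S : finSemigroupType) (U : subsemigroup S) :
  finSemigroupType := subsg_type U.

Section DffunSemigroup.
Variables (I : finType) (S : I -> finSemigroupType).
Definition dffun_mulsg (f g : {dffun forall i, S i}) :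
  {dffun forall i, S i} := [ffun i => f i * g i].
Lemma dffun_mulsgA : associative dffun_mulsg.
Proof. by move=> f g h; apply/ffunP => i; rewrite !ffunE mulgA. Qed.
HB.instance Definition _ :=
  isSemigroup.Build {dffun forall i, S i} dffun_mulsgA.
End DffunSemigroup.

Definition surjective (S T : finType) (f : S -> T) :=
  forall y, exists x, f x = y.

Definition sg_class := finSemigroupType -> Prop.

(* I may be empty, so a pseudovariety contains the one-element semigroup. *)
Record is_pseudovariety (V : sg_class) : Prop := {
  pv_sub : forall (S : finSemigroupType) (U : subsemigroup S),
    V S -> V (sg_of U);
  pv_img : forall (S T : finSemigroupType) (f : {multiplicative S -> T}),
    surjective f -> V S -> V T;
  pv_prod : forall (I : finType) (S : I -> finSemigroupType),
    (forall i, V (S i)) -> V {dffun forall i, S i}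
}.

Definition sing (S : finType) : {set {set S}} := [set [set x] | x : S].

Definition sg_rule := forall S : finSemigroupType, {set {set S}}.

Record is_modulus (L : sg_rule) : Prop := {
  mod_neq0 : forall (S : finSemigroupType) (X : {set S}),
    X \in L S -> X != set0;
  mod_hom : forall (S T : finSemigroupType) (f : {multiplicative S -> T}),
    forall X : {set S}, X \in L S ->
    exists2 X' : {set T}, X' \in L T & f @: X \subset X';
  mod_surj : forall (S T : finSemigroupType) (f : {multiplicative S -> T}),
    surjective f -> forall Y : {set T}, Y \in L T ->
    exists2 Y' : {set S}, Y' \in L S & f @: Y' = Y
}.

Record modulus := Modulus {
  modulus_rule :> sg_rule;
  modulus_axiom : is_modulus modulus_rule
}.

Definition refines (L1 L2 : sg_rule) : Prop :=
  forall (S : finSemigroupType) (X1 : {set S}), X1 \in L1 S ->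
  exists2 X2 : {set S}, X2 \in L2 S & X1 \subset X2.

Definition join (L1 L2 : sg_rule) : sg_rule := fun S => L1 S :|: L2 S.

Definition pt (L : sg_rule) : sg_class := fun S => L S \subset sing S.

Definition context_rule :=
  forall S : finSemigroupType, {set subsemigroup S}.

Record is_context_specifier (O : context_rule) : Prop := {
  ctx_hom : forall (S T : finSemigroupType) (f : {multiplicative S -> T}),
    forall US : subsemigroup S, US \in O S ->
    exists2 UT : subsemigroup T, UT \in O T & f @: US \subset UT;
  ctx_surj : forall (S T : finSemigroupType) (f : {multiplicative S -> T}),
    surjective f -> forall UT : subsemigroup T, UT \in O T ->
    exists2 US : subsemigroup S, US \in O S & f @: US = UT
}.

Record context_specifier := ContextSpecifier {
  context_specifier_rule :> context_rule;
  context_specifier_axiom : is_context_specifier context_specifier_rule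
}.

Definition restriction (O : context_rule) (L : sg_rule) : sg_rule :=
  fun S => \bigcup_(U in O S)
    [set [set val x | x in X] | X : {set sg_of U} in L (sg_of U)].

Definition In_ctx (O : context_rule) (V : sg_class) : sg_class :=
  fun S => forall U : subsemigroup S, U \in O S -> V (sg_of U).

(* The objects above live in the expected places: joins of moduli are moduli,
   and pt and In_ctx O take values in pseudovarieties. *)

Lemma join_is_modulus (L1 L2 : modulus) : is_modulus (join L1 L2).
Proof.
have [n1 h1 s1] := modulus_axiom L1; have [n2 h2 s2] := modulus_axiom L2.
split=> [S X | S T f X | S T f fsurj Y]; rewrite in_setU => /orP[] LX.
- exact: n1.
- exact: n2.
- by have [X' LX' sX] := h1 _ _ f _ LX; exists X'; rewrite // in_setU LX'.
- by have [X' LX' sX] := h2 _ _ f _ LX; exists X'; rewrite // in_setU LX' orbT.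
- by have [X' LX' eX] := s1 _ _ f fsurj _ LX; exists X'; rewrite // in_setU LX'.
- by have [X' LX' eX] := s2 _ _ f fsurj _ LX;
    exists X'; rewrite // in_setU LX' orbT.
Qed.

Lemma singP (S : finType) (X : {set S}) :
  X != set0 -> {in X &, forall x y, x = y} -> X \in sing S.
Proof.
case/set0Pn=> x Xx eqX; apply/imsetP; exists x => //.
apply/setP=> y; rewrite inE; apply/idP/eqP => [Xy | -> //].
exact: eqX.
Qed.

Lemma sing_eq (S : finType) (X Y : {set S}) :
  X \subset Y -> Y \in sing S -> {in X &, forall x y, x = y}.
Proof.
move=> sXY /imsetP[z _ defY] x y /(subsetP sXY) + /(subsetP sXY).
by rewrite defY => /set1P-> /set1P->.
Qed.

Lemma pt_is_pseudovariety (L : modulus) : is_pseudovariety (pt L).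
Proof.
have [n h s] := modulus_axiom L.
split=> [S U /subsetP LS | S T f fsurj /subsetP LS | I S LS].
- apply/subsetP=> X LX; apply: singP (n _ _ LX) _ => x y Xx Xy.
  have [X' LX' sX] := h _ _ (val : {multiplicative sg_of U -> S}) _ LX.
  by apply: val_inj; apply: (sing_eq sX (LS _ LX')); apply: imset_f.
- apply/subsetP=> Y LY; have [X LX <-] := s _ _ f fsurj _ LY.
  have /imsetP[x _ ->] := LS _ LX.
  by apply/imsetP; exists (f x); rewrite ?imset_set1.
- apply/subsetP=> X LX; apply: singP (n _ _ LX) _ => x y Xx Xy.
  apply/ffunP=> i.
  have pM : {morph (fun u : {dffun forall i, S i} => u i) : u v / u * v}.
    by move=> u v; rewrite ffunE.
  pose p : {multiplicative {dffun forall i, S i} -> S i} :=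
    HB.pack (fun u : {dffun forall i, S i} => u i)
      (isMultiplicative.Build _ _ _ pM).
  have [X' LX' sX] := h _ _ p _ LX.
  by apply: (sing_eq sX (subsetP (LS i) _ LX')); apply: (imset_f p).
Qed.

Lemma imset_subsg_closed (S T : finSemigroupType)
    (f : {multiplicative S -> T}) :
  [forall x in f @: [set: S], forall y in f @: [set: S],
     x * y \in f @: [set: S]].
Proof.
apply/forall_inP=> _ /imsetP[x _ ->]; apply/forall_inP=> _ /imsetP[y _ ->].
by rewrite -gmulfM imset_f.
Qed.

Lemma pv_inj (V : sg_class) (S T : finSemigroupType)
    (f : {multiplicative S -> T}) :
  is_pseudovariety V -> injective f -> V T -> V S.
Proof.
move=> [sub img _] finj VT; pose W := Subsemigroup (imset_subsg_closed f).
have gP (w : sg_of W) : {x | f x == val w}.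
  by apply: sigW; have /imsetP[x _ ->] := valP w; exists x.
pose g w := sval (gP w).
have gE w : f (g w) = val w := eqP (svalP (gP w)).
have gM : {morph g : u v / u * v}.
  by move=> u v; apply: finj; rewrite gmulfM !gE gmulfM.
pose g' : {multiplicative sg_of W -> S} :=
  HB.pack g (isMultiplicative.Build _ _ _ gM).
apply: (img _ _ g') (sub _ W VT) => x.
have Wx : f x \in W by apply: imset_f.
exists (Sub (f x) Wx : subsg_type W).
by apply: finj; rewrite [LHS]gE SubK.
Qed.

Lemma pv_inclusion (V : sg_class) (S T : finSemigroupType)
    (f : {multiplicative S -> T}) (U : subsemigroup S) (W : subsemigroup T) :
  is_pseudovariety V -> f @: U \subset W -> injective f ->
  V (sg_of W) -> V (sg_of U).
Proof.
move=> pV sUW finj.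
have Wf (u : sg_of U) : f (val u) \in W.
  by apply: (subsetP sUW); apply/imset_f/(valP u).
pose g u : sg_of W := Sub (f (val u)) (Wf u) : subsg_type W.
have gM : {morph g : u v / u * v}.
  by move=> u v; apply: val_inj; rewrite gmulfM !SubK !gmulfM.
pose g' : {multiplicative sg_of U -> sg_of W} :=
  HB.pack g (isMultiplicative.Build _ _ _ gM).
apply: (pv_inj (f := g') pV) => u v /(congr1 val); rewrite !SubK.
by move=> /finj/val_inj.
Qed.

Lemma In_ctx_is_pseudovariety (O : context_specifier) (V : sg_class) :
  is_pseudovariety V -> is_pseudovariety (In_ctx O V).
Proof.
move=> pV; have [h s] := context_specifier_axiom O; have [sub img prod] := pV.
split=> [S U VS W OW | S T f fsurj VS UT OUT | I S VS U OU].
- have [W' OW' sW] := h _ _ (val : {multiplicative sg_of U -> S}) _ OW.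
  exact: (pv_inclusion pV sW val_inj (VS _ OW')).
- have [US OUS eU] := s _ _ f fsurj _ OUT.
  have Uf (u : sg_of US) : f (val u) \in UT.
    by rewrite -eU; apply/imset_f/(valP u).
  pose g u : sg_of UT := Sub (f (val u)) (Uf u) : subsg_type UT.
  have gM : {morph g : u v / u * v}.
    by move=> u v; apply: val_inj; rewrite gmulfM !SubK !gmulfM.
  pose g' : {multiplicative sg_of US -> sg_of UT} :=
    HB.pack g (isMultiplicative.Build _ _ _ gM).
  apply: (img _ _ g') (VS _ OUS) => w.
  have /imsetP[x Ux ex] : val w \in f @: US by rewrite eU; exact: valP w.
  by exists (Sub x Ux : subsg_type US); apply: val_inj; rewrite !SubK.
- have p i : {p : {multiplicative {dffun forall i, S i} -> S i}
                | forall u, p u = u i}.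
    have pM : {morph (fun u : {dffun forall i, S i} => u i) : u v / u * v}.
      by move=> u v; rewrite ffunE.
    pose q : {multiplicative {dffun forall i, S i} -> S i} :=
      HB.pack (fun u : {dffun forall i, S i} => u i)
        (isMultiplicative.Build _ _ _ pM).
    by exists q.
  have W i : {W : subsemigroup (S i) |
      W \in (O : context_rule) (S i) & sval (p i) @: U \subset W}.
    by apply: sig2W; have [W] := h _ _ (sval (p i)) _ OU; exists W.
  have Wu i (u : sg_of U) : val u i \in s2val (W i).
    apply: (subsetP (s2valP' (W i))); rewrite -(svalP (p i)).
    exact/imset_f/(valP u).
  pose g (u : sg_of U) : {dffun forall i, sg_of (s2val (W i))} :=
    [ffun i => Sub (val u i) (Wu i u) : subsg_type _].
  have gE u i : val (g u i) = val u i by rewrite ffunE SubK.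
  have gM : {morph g : u v / u * v}.
    move=> u v; apply/ffunP=> i; rewrite [RHS]ffunE; apply: val_inj.
    by rewrite gmulfM gE gmulfM [LHS]ffunE -!gE.
  pose g' : {multiplicative sg_of U -> {dffun forall i, sg_of (s2val (W i))}} :=
    HB.pack g (isMultiplicative.Build _ _ _ gM).
  apply: (pv_inj (f := g') pV); last first.
    by apply: prod => i; apply: VS; apply: (s2valP (W i)).
  move=> u v euv; apply: val_inj; apply/ffunP=> i.
  by have /ffunP/(_ i)/(congr1 val) := euv; rewrite [LHS]gE [RHS]gE.
Qed.

(* Main.v *)
Require Import Defs.
From HB Require Import structures.
From mathcomp Require Import all_boot.

(** A member of [restriction O L S] is the image, under the inclusion of some
    [U \in O S], of a member of [L (sg_of U)].  The theorem holds because every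
    homomorphism [f : S -> T] with [f @: U \subset W] restricts to a
    homomorphism from [U] to [W] which commutes with the inclusions
    ([subsg_hom]): the axioms of the context specifier supply the pair [U],
    [W], and the axioms of the modulus are then applied to the restricted
    homomorphism.  Refinement is the homomorphism axiom of [L] for the
    inclusion of [U] in [S].  The join formula is the distribution of unions
    over images.  The formula for points holds because an inclusion is
    injective, so that it both preserves and reflects being a singleton
    ([imset_val_sing]). *)

Lemma restrictionP (O : context_rule) (L : sg_rule) (S : finSemigroupType)
    (X : {set S}) :
  reflect (exists U : subsemigroup S, exists Z : {set sg_of U},
             [/\ U \in O S, Z \in L (sg_of U) & X = val @: Z])
          (X \in restriction O L S).
Proof.
apply: (iffP bigcupP) => [[U OU /imsetP[Z LZ ->]] | [U [Z [OU LZ ->]]]].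
  by exists U, Z.
by exists U => //; apply: imset_f.
Qed.

(** A context specifier relates [U] and [W] only as sets, by [f @: U \subset W]
    or [f @: U = W]; a modulus can only be transported along a homomorphism of
    semigroups, which this lemma provides. *)
Lemma subsg_hom (S T : finSemigroupType) (f : {multiplicative S -> T})
    (U : subsemigroup S) (W : subsemigroup T) :
  f @: U \subset W ->
  exists g : {multiplicative sg_of U -> sg_of W},
    forall u, val (g u) = f (val u).
Proof.
move=> sUW.
have Wf (u : sg_of U) : f (val u) \in W.
  by apply: (subsetP sUW); apply/imset_f/(valP u).
pose g u : sg_of W := Sub (f (val u)) (Wf u) : subsg_type W.
have gM : {morph g : u v / (u * v)%g}.
  by move=> u v; apply: val_inj; rewrite gmulfM !SubK !gmulfM.
pose g' : {multiplicative sg_of U -> sg_of W} :=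
  HB.pack g (isMultiplicative.Build _ _ _ gM).
by exists g' => u; rewrite SubK.
Qed.

Lemma imset_val_hom (S T : finSemigroupType) (f : {multiplicative S -> T})
    (U : subsemigroup S) (W : subsemigroup T)
    (g : {multiplicative sg_of U -> sg_of W}) (Z : {set sg_of U}) :
  (forall u, val (g u) = f (val u)) -> f @: (val @: Z) = val @: (g @: Z).
Proof.
by move=> gE; rewrite -!imset_comp; apply: eq_imset => u; rewrite /= gE.
Qed.

Lemma restriction_is_modulus (O : context_specifier) (L : modulus) :
  is_modulus (restriction O L).
Proof.
have [Oh Os] := context_specifier_axiom O; have [Ln Lh Ls] := modulus_axiom L.
split=> [S X | S T f X | S T f fsurj Y] /restrictionP.
- by case=> U [Z [_ LZ ->]]; rewrite imset_eq0; apply: Ln LZ.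
- case=> U [Z [OU LZ ->]]; have [W OW sUW] := Oh _ _ f _ OU.
  have [g gE] := subsg_hom _ _ _ _ _ sUW; have [Z' LZ' sZ] := Lh _ _ g _ LZ.
  exists (val @: Z'); first by apply/restrictionP; exists W, Z'.
  by rewrite (imset_val_hom _ _ _ _ _ _ _ gE) imsetS.
- case=> W [Z [OW LZ ->]]; have [U OU eUW] := Os _ _ f fsurj _ OW.
  have [g gE] : exists g : {multiplicative sg_of U -> sg_of W},
      forall u, val (g u) = f (val u) by apply: subsg_hom; rewrite eUW.
  (* The surjectivity axiom of the modulus applies because f maps U onto W. *)
  have gsurj : surjective g.
    move=> w; have /imsetP[x Ux ex] : val w \in f @: U.
      by rewrite eUW; exact: valP w.
    exists (Sub x Ux : subsg_type U); apply: val_inj.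
    by rewrite gE SubK.
  have [Z' LZ' <-] := Ls _ _ g gsurj _ LZ.
  exists (val @: Z'); first by apply/restrictionP; exists U, Z'.
  exact: imset_val_hom.
Qed.

Lemma restriction_refines (O : context_rule) (L : modulus) :
  refines (restriction O L) L.
Proof.
move=> S _ /restrictionP[U [Z [_ LZ ->]]].
exact: (mod_hom (modulus_axiom L) (val : {multiplicative sg_of U -> S}) LZ).
Qed.

Lemma restriction_join (O : context_rule) (L1 L2 : sg_rule)
    (S : finSemigroupType) :
  restriction O (join L1 L2) S =
  join (restriction O L1) (restriction O L2) S.
Proof.
rewrite /restriction /join -big_split /=.
by apply: eq_bigr => U _; apply: imsetU.
Qed.

Lemma imset_val_sing (S : finSemigroupType) (U : subsemigroup S)
    (Z : {set sg_of U}) :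
  (val @: Z \in sing S) = (Z \in sing (sg_of U)).
Proof.
apply/idP/idP => [Zsing | /imsetP[u _ ->]]; last first.
  by rewrite imset_set1 imset_f.
apply: singP => [|u v Zu Zv].
  case/imsetP: Zsing => x _ eZ.
  by rewrite -(imset_eq0 val) eZ -cards_eq0 cards1.
apply: val_inj.
by apply: (sing_eq (subxx _) Zsing); apply: imset_f.
Qed.

Lemma pt_restriction (O : context_rule) (L : sg_rule) (S : finSemigroupType) :
  pt (restriction O L) S <-> In_ctx O (pt L) S.
Proof.
split=> [/subsetP ptS U OU | InS].
  apply/subsetP=> Z LZ; rewrite -imset_val_sing; apply: ptS.
  by apply/restrictionP; exists U, Z.
apply/subsetP=> _ /restrictionP[U [Z [OU LZ ->]]].
by rewrite imset_val_sing; apply: (subsetP (InS U OU)).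
Qed.

Theorem mainTheorem5 (O : context_specifier) :
  (forall L : modulus,
     is_modulus (restriction O L) /\ refines (restriction O L) L)
  /\
  (forall (L1 L2 : modulus) (S : finSemigroupType),
     restriction O (join L1 L2) S =
     join (restriction O L1) (restriction O L2) S)
  /\
  (forall (L : modulus) (S : finSemigroupType),
     pt (restriction O L) S <-> In_ctx O (pt L) S).
Proof.
split; last by split=> *; [apply: restriction_join | apply: pt_restriction].
by move=> L; split; [apply: restriction_is_modulus | apply: restriction_refines].
Qed.
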